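(* Let $\Phi:\mathbb{M}_m\to\mathbb{M}_n$ be a Hermitian linear map with Jordan decomposition $\Phi=\Phi^+-\Phi^-$, where $\Phi^+$ and $\Phi^-$ are the completely positive maps corresponding to the positive and negative parts of the Choi matrix $\mathbf{C}_\Phi$, respectively. Then the best approximation of $\Phi$ by a completely positive map $\Psi:\mathbb{M}_m\to\mathbb{M}_n$ in the Hilbert-Schmidt norm is $\Psi=\Phi^+$, and $$\min_{\Psi\ \text{completely positive}}\|\Phi-\Psi\|_{HS}=\|\Phi-\Phi^+\|_{HS}=\|\Phi^-\|_{HS}.$$
   Context: $\mathbb{M}_m$ is the algebra of $m\times m$ complex matrices. A linear map $\Phi:\mathbb{M}_m\to\mathbb{M}_n$ is Hermitian if $\Phi(A^* )=\Phi(A)^*$ for all $A\in\mathbb{M}_m$. It is completely positive if for every $k\ge 1$ the map $\mathrm{id}_{\mathbb{M}_k}\otimes\Phi:\mathbb{M}_k\otimes\mathbb{M}_m\to\mathbb{M}_k\otimes\mathbb{M}_n$ sends positive semi-definite matrices to positive semi-definite matrices. The Choi matrix of $\Phi$ is $\mathbf{C}_\Phi=\sum_{i,j=1}^m E_{ij}\otimes\Phi(E_{ij})\in\mathbb{M}_m\otimes\mathbb{M}_n$, where $E_{ij}$ are the standard matrix units of $\mathbb{M}_m$; the assignment $\Phi\mapsto\mathbf{C}_\Phi$ is a linear isomorphism, and $\Phi$ is completely positive if and only if $\mathbf{C}_\Phi$ is positive semi-definite. The Hilbert-Schmidt norm of $\Phi$ is $\|\Phi\|_{HS}=\sqrt{\operatorname{tr}(\mathbf{C}_\Phi^*\mathbf{C}_\Phi)}$.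 For a Hermitian matrix $A$, the positive and negative parts are $A^+=\frac12(A+|A|)$ and $A^-=\frac12(|A|-A)$, with $|A|=(A^*A)^{1/2}$, and $A=A^+-A^-$ is its Jordan decomposition. For Hermitian $\Phi$ (so that $\mathbf{C}_\Phi$ is Hermitian), $\Phi^+$ and $\Phi^-$ denote the linear maps $\mathbb{M}_m\to\mathbb{M}_n$ whose Choi matrices are $\mathbf{C}_\Phi^+$ and $\mathbf{C}_\Phi^-$, respectively. *)

(* Defs.v *)
From HB Require Import structures.
From mathcomp Require Import all_boot all_order all_algebra.
From mathcomp Require Import spectral sesquilinear.
From mathcomp Require Export reals complex.
From mathcomp Require Import mxtens.

Set Implicit Arguments.
Unset Strict Implicit.
Unset Printing Implicit Defensive.

Import Order.TTheory GRing.Theory Num.Theory.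
Local Open Scope ring_scope.
Local Open Scope sesquilinear_scope.

(* The definitions are given over a numClosedFieldType C, whose order is
   partial: 0 <= z means that z is real and nonnegative. *)

Section Matrices.
Variable C : numClosedFieldType.

Definition psdmx d (A : 'M[C]_d) : Prop :=
  A \is hermsymmx /\ forall x : 'cV[C]_d, 0 <= (x ^t* *m A *m x) 0 0.

(* The square root of a positive semi-definite matrix, by functional calculus
   on a unitary diagonalization; irrelevant value when A is not normal. *)
Definition sqrtmx d (A : 'M[C]_d) : 'M[C]_d :=
  (spectralmx A) ^t* *m diag_mx (map_mx sqrtC (spectral_diag A))
    *m spectralmx A.

Definition absmx d (A : 'M[C]_d) : 'M[C]_d := sqrtmx (A ^t* *m A).

Definition posmx d (A : 'M[C]_d) : 'M[C]_d := 2^-1 *: (A + absmx A).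

Definition negmx d (A : 'M[C]_d) : 'M[C]_d := 2^-1 *: (absmx A - A).

(* 'M_(k * m) stands for M_k (x) M_m: the index mxtens_index (i, a) is the
   position of e_i (x) e_a. *)
Definition tblock k m (X : 'M[C]_(k * m)) (i j : 'I_k) : 'M[C]_m :=
  \matrix_(a, b) X (mxtens_index (i, a)) (mxtens_index (j, b)).

End Matrices.

Section Maps.
Variable C : numClosedFieldType.

Definition hermitian_map m n (Phi : 'M[C]_m -> 'M[C]_n) : Prop :=
  forall A, Phi (A ^t*) = (Phi A) ^t*.

(* id_{M_k} (x) Phi *)
Definition amplify k m n (Phi : 'M[C]_m -> 'M[C]_n) (X : 'M[C]_(k * m)) :
    'M[C]_(k * n) :=
  \sum_(i < k) \sum_(j < k) (delta_mx i j : 'M[C]_k) *t Phi (tblock X i j).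

Definition completely_positive m n (Phi : 'M[C]_m -> 'M[C]_n) : Prop :=
  forall k, (0 < k)%N ->
    forall X : 'M[C]_(k * m), psdmx X -> psdmx (amplify Phi X).

Definition choi m n (Phi : 'M[C]_m -> 'M[C]_n) : 'M[C]_(m * n) :=
  \sum_(i < m) \sum_(j < m)
    (delta_mx i j : 'M[C]_m) *t Phi (delta_mx i j).

(* The inverse of the isomorphism choi. *)
Definition of_choi m n (M : 'M[C]_(m * n)) (A : 'M[C]_m) : 'M[C]_n :=
  \sum_(i < m) \sum_(j < m) A i j *: tblock M i j.

Lemma of_choi_is_linear m n (M : 'M[C]_(m * n)) : linear (of_choi M).
Proof.
move=> a A B; rewrite /of_choi scaler_sumr -big_split /=.
apply: eq_bigr => i _; rewrite scaler_sumr -big_split /=.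
by apply: eq_bigr => j _; rewrite !mxE scalerDl scalerA.
Qed.

HB.instance Definition _ m n (M : 'M[C]_(m * n)) :=
  GRing.isLinear.Build C 'M[C]_m 'M[C]_n *:%R (of_choi M)
    (of_choi_is_linear M).

Definition pos_map m n (Phi : 'M[C]_m -> 'M[C]_n) :
  {linear 'M[C]_m -> 'M[C]_n} := of_choi (posmx (choi Phi)).

Definition neg_map m n (Phi : 'M[C]_m -> 'M[C]_n) :
  {linear 'M[C]_m -> 'M[C]_n} := of_choi (negmx (choi Phi)).

Definition hsnorm m n (Phi : 'M[C]_m -> 'M[C]_n) : C :=
  sqrtC (\tr ((choi Phi) ^t* *m choi Phi)).

Definition is_best_cp_approx m n (Phi Psi : 'M[C]_m -> 'M[C]_n) : Prop :=
  completely_positive Psi /\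
  forall Psi' : {linear 'M[C]_m -> 'M[C]_n}, completely_positive Psi' ->
    hsnorm (Phi \- Psi) <= hsnorm (Phi \- Psi').

Definition cp_distances m n (Phi : 'M[C]_m -> 'M[C]_n) (r : C) : Prop :=
  exists Psi : {linear 'M[C]_m -> 'M[C]_n},
    completely_positive Psi /\ r = hsnorm (Phi \- Psi).

Definition is_minimum (S : C -> Prop) (r : C) : Prop :=
  S r /\ forall s, S s -> r <= s.

End Maps.

Section Facts.
Variable C : numClosedFieldType.

Lemma sum_delta_tensE k n (F : 'I_k -> 'I_k -> 'M[C]_n) i j a b :
  (\sum_(i' < k) \sum_(j' < k) (delta_mx i' j' : 'M[C]_k) *t F i' j')
    (mxtens_index (i, a)) (mxtens_index (j, b)) = F i j a b.
Proof.
rewrite summxE (bigD1 i) //= summxE (bigD1 j) //= tensmxE mxE !eqxx mul1r.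
rewrite !big1 ?addr0 // => [i' ni|j' nj].
  by rewrite summxE big1 // => j' _; rewrite tensmxE mxE eq_sym (negPf ni) mul0r.
by rewrite tensmxE mxE [j == _]eq_sym (negPf nj) andbF mul0r.
Qed.

Lemma eq_tblock k n (X Y : 'M[C]_(k * n)) :
  (forall i j, tblock X i j = tblock Y i j) -> X = Y.
Proof.
move=> eqXY; apply/matrixP => p q.
case: (mxtens_indexP p) => i a; case: (mxtens_indexP q) => j b.
by have /matrixP/(_ a b) := eqXY i j; rewrite !mxE.
Qed.

Lemma amplify_tens k m n (Phi : {linear 'M[C]_m -> 'M[C]_n})
    (A : 'M[C]_k) (B : 'M[C]_m) :
  amplify Phi (A *t B) = A *t Phi B.
Proof.
apply: eq_tblock => i j; apply/matrixP => a b.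
rewrite [LHS]mxE sum_delta_tensE [RHS]mxE tensmxE.
have -> : tblock (A *t B) i j = A i j *: B.
  by apply/matrixP => c d; rewrite mxE tensmxE mxE.
by rewrite linearZ mxE.
Qed.

Lemma tblock_choi m n (Phi : 'M[C]_m -> 'M[C]_n) i j :
  tblock (choi Phi) i j = Phi (delta_mx i j).
Proof. by apply/matrixP => a b; rewrite mxE sum_delta_tensE. Qed.

Lemma of_choiK m n (M : 'M[C]_(m * n)) : choi (of_choi M) = M.
Proof.
apply: eq_tblock => i j; rewrite tblock_choi /of_choi.
rewrite (bigD1 i) //= (bigD1 j) //= mxE !eqxx scale1r.
rewrite !big1 ?addr0 // => [i' ni|j' nj].
  by rewrite big1 // => j' _; rewrite mxE (negPf ni) scale0r.
by rewrite mxE (negPf nj) andbF scale0r.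
Qed.

Lemma choiK m n (Phi : {linear 'M[C]_m -> 'M[C]_n}) :
  of_choi (choi Phi) =1 Phi.
Proof.
move=> A; rewrite [in RHS](matrix_sum_delta A) linear_sum.
apply: eq_bigr => i _; rewrite linear_sum; apply: eq_bigr => j _.
by rewrite linearZ /= tblock_choi.
Qed.

Lemma psdmx_gram d (P : 'M[C]_d) : psdmx (P ^t* *m P).
Proof.
split=> [|x].
  by apply/is_hermitianmxP; rewrite expr0 scale1r trmx_mul map_mxM trmxCK.
rewrite mulmxA -mulmxA -map_mxM -trmx_mul mxE.
by apply: sumr_ge0 => i _; rewrite !mxE mulrC mul_conjC_ge0.
Qed.

Lemma spectral_diag_psd_ge0 d (A : 'M[C]_d) i :
  psdmx A -> 0 <= spectral_diag A 0 i.
Proof.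
move=> [hA pA].
have /orthomx_spectralP := hermitian_normalmx hA.
rewrite invmx_unitary ?spectral_unitarymx //.
set P := spectralmx A; set D := spectral_diag A => eA.
have PP : P *m P ^t* = 1%:M by apply/unitarymxP/spectral_unitarymx.
have eD : P *m A *m P ^t* = diag_mx D.
  by rewrite [in LHS]eA !mulmxA PP mul1mx -mulmxA PP mulmx1.
have := pA ((row i P) ^t*); rewrite trmxCK.
have -> : row i P *m A *m (row i P) ^t* = row i (P *m A) *m (row i P) ^t*.
  by rewrite row_mul.
have -> : (row i (P *m A) *m (row i P) ^t*) 0 0 = (P *m A *m P ^t*) i i.
  by rewrite !mxE; apply: eq_bigr => j _; rewrite !mxE.
by rewrite eD mxE eqxx mulr1n.
Qed.

Lemma sqrtmxP d (A : 'M[C]_d) : psdmx A ->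
  psdmx (sqrtmx A) /\ sqrtmx A *m sqrtmx A = A.
Proof.
move=> psdA; have D_ge0 i := spectral_diag_psd_ge0 i psdA.
have /orthomx_spectralP := hermitian_normalmx psdA.1.
rewrite invmx_unitary ?spectral_unitarymx //.
rewrite /sqrtmx; move: D_ge0 (spectral_unitarymx A).
set P := spectralmx A; set D := spectral_diag A => D_ge0 /unitarymxP PP eA.
split; last first.
  rewrite -!mulmxA (mulmxA P) PP mul1mx (mulmxA (diag_mx _)) mulmx_diag.
  rewrite [RHS]eA -mulmxA; congr (_ *m (diag_mx _ *m _)).
  by apply/rowP => j; rewrite !mxE -expr2 sqrtCK.
pose Q := diag_mx (map_mx (fun z => sqrtC (sqrtC z)) D).
suff -> : P ^t* *m diag_mx (map_mx sqrtC D) *m P = (Q *m P) ^t* *m (Q *m P).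
  exact: psdmx_gram.
have Qh : Q ^t* = Q.
  rewrite /Q tr_diag_mx map_diag_mx; congr diag_mx; apply/rowP => j.
  by rewrite !mxE; apply: geC0_conj; rewrite !sqrtC_ge0.
rewrite trmx_mul map_mxM Qh -!mulmxA; congr (_ *m _).
rewrite mulmxA mulmx_diag; congr (diag_mx _ *m _).
by apply/rowP => j; rewrite !mxE -expr2 sqrtCK.
Qed.

Lemma absmxP d (A : 'M[C]_d) :
  psdmx (absmx A) /\ absmx A *m absmx A = A ^t* *m A.
Proof. exact/sqrtmxP/psdmx_gram. Qed.

End Facts.

(* Main.v *)
Require Import Defs.
From mathcomp Require Import all_boot all_order all_algebra.
From mathcomp Require Import reals complex.
From mathcomp Require Import spectral sesquilinear mxtens.

(** Through the Choi isomorphism the statement becomes a nearest-point problem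
    in the cone of positive semi-definite matrices. Write M for the Choi matrix
    of Phi, which is Hermitian because Phi is, and M = P - N for its Jordan
    decomposition. By Choi's theorem ([psdmx_choi] and
    [completely_positive_of_choi]) the Choi matrices X of the competitors Psi
    are exactly the positive semi-definite ones, and P N = 0 gives
      |M - X|^2 = |(P - X) - N|^2 = |P - X|^2 + |N|^2 + 2 tr (X N)
    ([trace_gram_sub_psdmx]). As X and N are positive semi-definite,
    tr (X N) >= 0, so the distance is at least |N|, and it equals |N| only
    when X = P; conversely X = P achieves |N|.

    That P and N are positive semi-definite and orthogonal is derived from only
    two properties of |M|: its square is M^2 ([absmx_sqr]), and it commutes with
    M, since a square root obtained by functional calculus commutes with
    whatever commutes with the original matrix ([sqrtmx_comm]). They yield
    N P = 0 and P^3 = P |M| P, which is positive semi-definite, and a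
    Hermitian matrix with a positive semi-definite cube is itself positive
    semi-definite ([psdmx_cube]).

    Everything takes place over an arbitrary numClosedFieldType; the case of
    R[i] is specialized only in the theorem. *)

Set Implicit Arguments.
Unset Strict Implicit.
Unset Printing Implicit Defensive.

Import Order.TTheory GRing.Theory Num.Theory.
Local Open Scope ring_scope.

(** * Positive semi-definite matrices *)

Section PositiveSemidefinite.
Local Open Scope sesquilinear_scope.
Variable C : numClosedFieldType.

Lemma adj_mulmx p q r (A : 'M[C]_(p, q)) (B : 'M[C]_(q, r)) :
  (A *m B) ^t* = B ^t* *m A ^t*.
Proof. by rewrite trmx_mul map_mxM. Qed.

Lemma adj_mxN p q (A : 'M[C]_(p, q)) : (- A) ^t* = - A ^t*.
Proof. by apply/matrixP => i j; rewrite !mxE rmorphN. Qed.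

Lemma adj_mxB p q (A B : 'M[C]_(p, q)) : (A - B) ^t* = A ^t* - B ^t*.
Proof. by apply/matrixP => i j; rewrite !mxE rmorphB. Qed.

Lemma hermsymmxE d (A : 'M[C]_d) : A \is hermsymmx <-> A ^t* = A.
Proof.
split=> [/is_hermitianmxP|hA]; first by rewrite expr0 scale1r => <-.
by apply/is_hermitianmxP; rewrite expr0 scale1r hA.
Qed.

Lemma psdmx_adj d (A : 'M[C]_d) : psdmx A -> A ^t* = A.
Proof. by case=> /hermsymmxE. Qed.

Lemma psdmx0 d : psdmx (0 : 'M[C]_d).
Proof.
split=> [|x]; first by apply/hermsymmxE; rewrite trmx0 map_mx0.
by rewrite mulmx0 mul0mx mxE.
Qed.

Lemma psdmxD d (A B : 'M[C]_d) : psdmx A -> psdmx B -> psdmx (A + B).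
Proof.
move=> pA pB; split=> [|x].
  by apply/hermsymmxE; rewrite linearD map_mxD !psdmx_adj.
by rewrite mulmxDr mulmxDl mxE addr_ge0 ?pA.2 ?pB.2.
Qed.

Lemma psdmx_congr p q (A : 'M[C]_p) (B : 'M[C]_(p, q)) :
  psdmx A -> psdmx (B ^t* *m A *m B).
Proof.
move=> pA; split=> [|x].
  by apply/hermsymmxE; rewrite !adj_mulmx trmxCK psdmx_adj // mulmxA.
have -> : x ^t* *m (B ^t* *m A *m B) *m x = (B *m x) ^t* *m A *m (B *m x).
  by rewrite adj_mulmx !mulmxA.
exact: pA.2.
Qed.

Lemma psdmx_gram_rect p q (B : 'M[C]_(p, q)) : psdmx (B ^t* *m B).
Proof.
have := psdmx_congr B (psdmx_gram 1%:M).
by rewrite trmx1 map_mx1 mul1mx mulmx1.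
Qed.

Lemma psdmx_diag_ge0 d (A : 'M[C]_d) i : psdmx A -> 0 <= A i i.
Proof.
move=> /(psdmx_congr (delta_mx i (0 : 'I_1)))[_ /(_ 1%:M)].
rewrite trmx1 map_mx1 mul1mx mulmx1 trmx_delta map_delta_mx -rowE -colE.
by rewrite !mxE.
Qed.

Lemma psdmx_trace_ge0 d (A : 'M[C]_d) : psdmx A -> 0 <= \tr A.
Proof. by move=> pA; apply: sumr_ge0 => i _; apply: psdmx_diag_ge0. Qed.

(** With S the square root of A, cyclicity turns tr (A B) into tr (S B S). *)
Lemma psdmx_trace_mul_ge0 d (A B : 'M[C]_d) :
  psdmx A -> psdmx B -> 0 <= \tr (A *m B).
Proof.
move=> pA pB; have [/psdmx_adj hS SS] := sqrtmxP pA.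
rewrite -SS -mulmxA mxtrace_mulC -{1}hS.
exact/psdmx_trace_ge0/psdmx_congr.
Qed.

Lemma trace_gram_eq0 d (X : 'M[C]_d) : \tr (X ^t* *m X) = 0 -> X = 0.
Proof.
have tE : \tr (X ^t* *m X) = \sum_i \sum_j X j i * (X j i)^*.
  by apply: eq_bigr => i _; rewrite mxE; apply: eq_bigr => j _; rewrite !mxE mulrC.
rewrite tE => /eqP; rewrite psumr_eq0 => [|i _]; last first.
  by apply: sumr_ge0 => j _; apply: mul_conjC_ge0.
move=> /allP X0; apply/matrixP => j i; rewrite mxE; apply/eqP.
have := X0 i (mem_index_enum _); rewrite /= psumr_eq0 => [/allP|k _]; last first.
  exact: mul_conjC_ge0.
by move=> /(_ j (mem_index_enum _)) /=; rewrite mul_conjC_eq0.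
Qed.

Lemma spectral_decomposition d (A : 'M[C]_d) : A \is normalmx ->
  A = (spectralmx A) ^t* *m diag_mx (spectral_diag A) *m spectralmx A.
Proof.
by move/orthomx_spectralP; rewrite invmx_unitary ?spectral_unitarymx.
Qed.

Lemma psdmx_diag d (D : 'rV[C]_d) :
  (forall i, 0 <= D 0 i) -> psdmx (diag_mx D).
Proof.
move=> D0.
have -> : diag_mx D = (diag_mx (map_mx sqrtC D)) ^t* *m diag_mx (map_mx sqrtC D).
  rewrite tr_diag_mx map_diag_mx mulmx_diag; congr diag_mx; apply/rowP => i.
  rewrite !mxE /= geC0_conj ?sqrtC_ge0 //.
  exact/esym/sqrtCK.
exact: psdmx_gram.
Qed.

(** The eigenvalues of a Hermitian matrix are real, and a real number whose
    cube is nonnegative is nonnegative. This gives the positivity of the Jordan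
    parts without identifying the eigenvalues of [absmx M] from those of M. *)
Lemma psdmx_cube d (A : 'M[C]_d) :
  A \is hermsymmx -> psdmx (A *m A *m A) -> psdmx A.
Proof.
move=> hA pA3.
have /unitarymxP PP := spectral_unitarymx A.
have D_real := hermitian_spectral_diag_real hA.
move: PP D_real (spectral_decomposition (hermitian_normalmx hA)).
set P := spectralmx A; set D := spectral_diag A => PP D_real eA.
rewrite eA; apply: psdmx_congr; apply: psdmx_diag => i.
have eD : P *m A *m P ^t* = diag_mx D.
  by rewrite [in LHS]eA !mulmxA PP mul1mx -mulmxA PP mulmx1.
have P'P : P ^t* *m P = 1%:M by apply: mulmx1C.
have eD3 : P *m (A *m A *m A) *m P ^t* = diag_mx D *m diag_mx D *m diag_mx D.
  rewrite -eD !mulmxA -!(mulmxA _ (P ^t*) P) P'P !mulmx1.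
  by rewrite -!mulmxA.
have := psdmx_diag_ge0 i (psdmx_congr (P ^t*) pA3).
rewrite trmxCK eD3 !mulmx_diag !mxE eqxx mulr1n -expr2 -exprSr.
by rewrite real_exprn_odd_ge0 // (mxOverP D_real).
Qed.

(** In an eigenbasis of A, commuting with A reads D_i X_ij = X_ij D_j: whenever
    X_ij is nonzero, D_i and D_j agree, hence so do their square roots. *)
Lemma sqrtmx_comm d (A B : 'M[C]_d) :
  psdmx A -> A *m B = B *m A -> sqrtmx A *m B = B *m sqrtmx A.
Proof.
move=> pA AB; have /unitarymxP PP := spectral_unitarymx A.
move: PP (spectral_decomposition (hermitian_normalmx pA.1)).
rewrite /sqrtmx; set P := spectralmx A; set D := spectral_diag A => PP eA.
have P'P : P ^t* *m P = 1%:M by apply: mulmx1C.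
have [X eB] : exists X, B = P ^t* *m X *m P.
  exists (P *m B *m P ^t*).
  by rewrite !mulmxA P'P mul1mx -mulmxA P'P mulmx1.
have conjM Y Z : (P ^t* *m Y *m P) *m (P ^t* *m Z *m P) = P ^t* *m (Y *m Z) *m P.
  by rewrite !mulmxA -(mulmxA _ P) PP mulmx1.
have DX : diag_mx D *m X = X *m diag_mx D.
  have : P ^t* *m (diag_mx D *m X) *m P = P ^t* *m (X *m diag_mx D) *m P.
    by rewrite -!conjM -eA -eB.
  move/(congr1 (fun Y => P *m Y *m P ^t*)).
  by rewrite !mulmxA PP !mul1mx -!(mulmxA _ P) PP !mulmx1.
rewrite eB !conjM; congr (_ *m _ *m _); apply/matrixP => i j.
move: DX => /matrixP/(_ i j).
rewrite !(mul_diag_mx, mul_mx_diag) !mxE.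
rewrite mulrC => /eqP; rewrite -subr_eq0 -mulrBr mulf_eq0 => /orP[/eqP->|].
  by rewrite mulr0 mul0r.
by rewrite subr_eq0 => /eqP ->; rewrite mulrC.
Qed.

End PositiveSemidefinite.

(** * The Jordan decomposition of a Hermitian matrix *)

Section JordanDecomposition.
Local Open Scope sesquilinear_scope.
Variables (C : numClosedFieldType) (d : nat).
Implicit Types M X : 'M[C]_d.

Lemma absmx_sqr M : M \is hermsymmx -> absmx M *m absmx M = M *m M.
Proof. by move/hermsymmxE=> hM; rewrite (absmxP M).2 hM. Qed.

Lemma absmx_comm M : M \is hermsymmx -> absmx M *m M = M *m absmx M.
Proof.
move/hermsymmxE=> hM; apply: sqrtmx_comm; first exact: psdmx_gram.
by rewrite hM mulmxA.
Qed.

(** As M and - M have the same absolute value, the properties of the negative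
    part follow from those of the positive part. *)
Lemma negmxE M : negmx M = posmx (- M).
Proof.
rewrite /negmx /posmx /absmx adj_mxN mulNmx mulmxN opprK.
by rewrite addrC.
Qed.

Lemma posmx_subr_negmx M : posmx M - negmx M = M.
Proof.
rewrite /posmx /negmx -scalerBr opprB addrA addrAC.
rewrite addrK -mulr2n -scaler_nat scalerA mulVf ?scale1r //.
by rewrite pnatr_eq0.
Qed.

(** The identity behind both the positivity of the Jordan parts and their
    orthogonality: on the range of its positive part, M acts as [absmx M]. *)
Lemma mul_posmx M : M \is hermsymmx -> M *m posmx M = absmx M *m posmx M.
Proof.
move=> hM; rewrite /posmx -!scalemxAr !mulmxDr absmx_sqr // absmx_comm //.
by rewrite addrC.
Qed.

(** By [mul_posmx] the square of P = posmx M is |M| P, so its cube P |M| P is a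
    congruence of |M|. *)
Lemma psdmx_posmx M : M \is hermsymmx -> psdmx (posmx M).
Proof.
move=> hM; have pT := (absmxP M).1.
have hP : (posmx M) ^t* = posmx M.
  rewrite /posmx linearZ map_mxZ linearD map_mxD (psdmx_adj pT) /=.
  by rewrite ((hermsymmxE M).1 hM) geC0_conj // invr_ge0 ler0n.
have PP : posmx M *m posmx M = absmx M *m posmx M.
  rewrite {1}/posmx -scalemxAl mulmxDl mul_posmx // -mulr2n -scaler_nat scalerA.
  by rewrite mulVf ?pnatr_eq0 // scale1r.
apply: psdmx_cube; first exact/hermsymmxE.
by rewrite -mulmxA PP mulmxA -{1}hP; apply: psdmx_congr.
Qed.

Lemma psdmx_negmx M : M \is hermsymmx -> psdmx (negmx M).
Proof.
move/hermsymmxE=> hM; rewrite negmxE; apply/psdmx_posmx/hermsymmxE.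
by rewrite adj_mxN hM.
Qed.

Lemma negmx_mul_posmx M : M \is hermsymmx -> negmx M *m posmx M = 0.
Proof.
by move=> hM; rewrite /negmx -scalemxAl mulmxBl mul_posmx // subrr scaler0.
Qed.

(** The squared distance from M to X splits into the squared distances from the
    positive part to X and from the positive part to M, plus a cross term which
    is nonnegative when X is positive semi-definite; the orthogonality of the
    two parts is what leaves only X in that cross term. *)
Lemma trace_gram_sub_psdmx M X : M \is hermsymmx -> psdmx X ->
  \tr ((M - X) ^t* *m (M - X)) =
  \tr ((posmx M - X) ^t* *m (posmx M - X)) + \tr ((negmx M) ^t* *m negmx M)
  + \tr (X *m negmx M) *+ 2.
Proof.
move=> hM pX; have hX := psdmx_adj pX.
have hP := psdmx_adj (psdmx_posmx hM); have hN := psdmx_adj (psdmx_negmx hM).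
have PN0 : posmx M *m negmx M = 0.
  by rewrite -hP -hN -adj_mulmx negmx_mul_posmx // trmx0 map_mx0.
have -> : M - X = posmx M - X - negmx M by rewrite addrAC posmx_subr_negmx.
have trKN : \tr ((posmx M - X) *m negmx M) = - \tr (X *m negmx M).
  by rewrite mulmxBl PN0 sub0r linearN.
rewrite !adj_mxB hP hN hX.
move: (posmx M - X) (negmx M) trKN => K N trKN.
rewrite mulmxBl !mulmxBr !linearB /= (mxtrace_mulC N) trKN.
by rewrite !opprK opprB opprK mulr2n !addrA; congr (_ + _); rewrite addrAC.
Qed.

End JordanDecomposition.

(** * Choi's theorem *)

Section Choi.
Local Open Scope sesquilinear_scope.
Variable C : numClosedFieldType.

Lemma eq_amplify k m n (Phi Psi : 'M[C]_m -> 'M[C]_n) (X : 'M[C]_(k * m)) :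
  Phi =1 Psi -> amplify Phi X = amplify Psi X.
Proof.
by move=> eq; apply: eq_bigr => i _; apply: eq_bigr => j _; rewrite eq.
Qed.

Lemma eq_completely_positive m n (Phi Psi : 'M[C]_m -> 'M[C]_n) :
  Phi =1 Psi -> completely_positive Phi -> completely_positive Psi.
Proof. by move=> eq cp k k0 X pX; rewrite -(eq_amplify X eq); apply: cp. Qed.

Lemma tblock_amplify k m n (Phi : 'M[C]_m -> 'M[C]_n) (X : 'M[C]_(k * m)) i j :
  tblock (amplify Phi X) i j = Phi (tblock X i j).
Proof. by apply/matrixP => a b; rewrite mxE sum_delta_tensE. Qed.

Lemma tblockD k n (X Y : 'M[C]_(k * n)) i j :
  tblock (X + Y) i j = tblock X i j + tblock Y i j.
Proof. by apply/matrixP => a b; rewrite !mxE. Qed.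

Lemma tblockB k n (X Y : 'M[C]_(k * n)) i j :
  tblock (X - Y) i j = tblock X i j - tblock Y i j.
Proof. by apply/matrixP => a b; rewrite !mxE. Qed.

Lemma sum_delta_tens_tblock k n (X : 'M[C]_(k * n)) :
  \sum_(i < k) \sum_(j < k) (delta_mx i j : 'M[C]_k) *t tblock X i j = X.
Proof.
by apply: eq_tblock => i j; apply/matrixP => a b; rewrite mxE sum_delta_tensE.
Qed.

Lemma completely_positiveD m n (Phi Psi : 'M[C]_m -> 'M[C]_n) :
  completely_positive Phi -> completely_positive Psi ->
  completely_positive (Phi \+ Psi).
Proof.
move=> cPhi cPsi k k0 X pX.
have -> : amplify (Phi \+ Psi) X = amplify Phi X + amplify Psi X.
  by apply: eq_tblock => i j; rewrite tblockD !tblock_amplify.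
by apply: psdmxD; [apply: cPhi | apply: cPsi].
Qed.

(** Amplifying a congruence by V gives the congruence by the tensor product of
    the identity with V. *)
Lemma completely_positive_congr m n (V : 'M[C]_(m, n)) :
  completely_positive (fun A => V ^t* *m A *m V).
Proof.
move=> k _ X /(psdmx_congr (1%:M *t V)); congr psdmx.
rewrite trmx_tens map_mxT trmx1 map_mx1 -{1}(sum_delta_tens_tblock X).
rewrite mulmx_sumr mulmx_suml; apply: eq_bigr => i _.
rewrite mulmx_sumr mulmx_suml; apply: eq_bigr => j _.
by rewrite !tensmx_mul mul1mx mulmx1.
Qed.

(** Kraus operators: a rank one Choi matrix comes from the congruence by the
    matrix obtained by reshaping its defining vector. *)
Lemma of_choi_rank1 m n (w : 'rV[C]_(m * n)) :
  let V := \matrix_(i, a) w 0 (mxtens_index (i, a)) in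
  of_choi (w ^t* *m w) =1 (fun A => V ^t* *m A *m V).
Proof.
move=> V A; apply/matrixP => a b.
rewrite /of_choi exchange_big /= summxE mxE; apply: eq_bigr => j _.
rewrite summxE mxE mulr_suml; apply: eq_bigr => i _.
rewrite !mxE big_ord1 !mxE mulrCA mulrA; congr (_ * _).
Qed.

(** A positive semi-definite matrix is the sum of the rank one Gram matrices of
    the rows of its square root, so the map is a sum of congruences. *)
Lemma completely_positive_of_choi m n (M : 'M[C]_(m * n)) :
  psdmx M -> completely_positive (of_choi M).
Proof.
move=> pM; have [/psdmx_adj hS SS] := sqrtmxP pM.
have -> : M = \sum_p (row p (sqrtmx M)) ^t* *m row p (sqrtmx M).
  rewrite -[LHS]SS -{1}hS; apply/matrixP => i j; rewrite summxE mxE.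
  by apply: eq_bigr => p _; rewrite !mxE big_ord1 !mxE.
elim/big_ind: _ => [|X Y cX cY|p _].
- move=> k k0 X _; suff -> : amplify (of_choi (0 : 'M[C]_(m * n))) X = 0 by apply: psdmx0.
  apply: eq_tblock => i j; rewrite tblock_amplify; apply/matrixP => a b.
  rewrite !mxE summxE big1 // => i' _; rewrite summxE big1 // => j' _.
  by rewrite !mxE mulr0.
- apply: eq_completely_positive (completely_positiveD cX cY) => A /=.
  rewrite -big_split; apply: eq_bigr => i _; rewrite -big_split.
  by apply: eq_bigr => j _; rewrite tblockD scalerDr.
- apply: eq_completely_positive (completely_positive_congr _) => A.
  by rewrite of_choi_rank1.
Qed.

(** The Choi matrix is the image, under the amplification by 'M_m, of the
    unnormalized maximally entangled state, a Gram matrix of rank one. *)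
Lemma psdmx_choi m n (Phi : 'M[C]_m -> 'M[C]_n) :
  completely_positive Phi -> psdmx (choi Phi).
Proof.
(* Complete positivity only speaks of amplifications by a nonzero size, so the
   empty Choi matrix is treated apart. *)
case: m Phi => [|m] Phi cp; first by rewrite [choi _]big_ord0; apply: psdmx0.
(* w is the sum of the e_i (x) e_i. *)
pose w : 'rV[C]_(m.+1 * m.+1) :=
  \row_p ((mxtens_unindex p).1 == (mxtens_unindex p).2)%:R.
have -> : choi Phi = amplify Phi (w ^t* *m w).
  apply: eq_tblock => i j; rewrite tblock_choi tblock_amplify; congr Phi.
  apply/matrixP => a b; rewrite !mxE big_ord1 !mxE !mxtens_indexK /=.
  by rewrite conjC_nat -natrM mulnb ![_ == i]eq_sym ![_ == j]eq_sym.
by apply: cp => //; apply: psdmx_gram_rect.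
Qed.

Lemma choi_hermitian m n (Phi : 'M[C]_m -> 'M[C]_n) :
  hermitian_map Phi -> choi Phi \is hermsymmx.
Proof.
move=> hPhi; apply/hermsymmxE/eq_tblock => i j.
rewrite tblock_choi -[delta_mx i j]trmxCK hPhi trmx_delta map_delta_mx.
by rewrite -tblock_choi; apply/matrixP => a b; rewrite !mxE.
Qed.

Lemma eq_choi m n (Phi Psi : 'M[C]_m -> 'M[C]_n) :
  Phi =1 Psi -> choi Phi = choi Psi.
Proof. by move=> eq; apply: eq_tblock => i j; rewrite !tblock_choi. Qed.

Lemma choiB m n (Phi Psi : 'M[C]_m -> 'M[C]_n) :
  choi (Phi \- Psi) = choi Phi - choi Psi.
Proof. by apply: eq_tblock => i j; rewrite tblockB !tblock_choi. Qed.

End Choi.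

(** * Approximation by completely positive maps *)

Section Approximation.
Local Open Scope sesquilinear_scope.
Variables (C : numClosedFieldType) (m n : nat).
Variable Phi : {linear 'M[C]_m -> 'M[C]_n}.
Hypothesis hermPhi : hermitian_map Phi.
Implicit Type Psi : {linear 'M[C]_m -> 'M[C]_n}.

Lemma eq_hsnorm (F G : 'M[C]_m -> 'M[C]_n) : F =1 G -> hsnorm F = hsnorm G.
Proof. by move=> eqFG; rewrite /hsnorm (eq_choi eqFG). Qed.

Lemma completely_positive_pos_map : completely_positive (pos_map Phi).
Proof.
exact/completely_positive_of_choi/psdmx_posmx/choi_hermitian.
Qed.

Lemma completely_positive_neg_map : completely_positive (neg_map Phi).
Proof.
exact/completely_positive_of_choi/psdmx_negmx/choi_hermitian.
Qed.

Lemma jordan_decomposition_map : Phi =1 (pos_map Phi \- neg_map Phi).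
Proof.
move=> A; rewrite -[LHS]choiK -[choi Phi in LHS]posmx_subr_negmx /=.
rewrite /of_choi -sumrB; apply: eq_bigr => i _.
by rewrite -sumrB; apply: eq_bigr => j _; rewrite tblockB scalerBr.
Qed.

Lemma hsnorm_sub_pos_map : hsnorm (Phi \- pos_map Phi) = hsnorm (neg_map Phi).
Proof.
rewrite /hsnorm choiB !of_choiK.
rewrite -{1 3}[choi Phi]posmx_subr_negmx addrAC subrr sub0r.
by rewrite adj_mxN mulNmx mulmxN opprK.
Qed.

(** The two discarded terms of [trace_gram_sub_psdmx] are nonnegative. *)
Lemma hsnorm_neg_map_le Psi :
  completely_positive Psi -> hsnorm (neg_map Phi) <= hsnorm (Phi \- Psi).
Proof.
move=> /psdmx_choi pX; have hM := choi_hermitian hermPhi.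
rewrite /hsnorm choiB of_choiK ler_sqrtC ?qualifE /= ?psdmx_trace_ge0 //;
  do ?exact: psdmx_gram.
rewrite trace_gram_sub_psdmx // -addrA addrCA lerDl addr_ge0 //.
  exact/psdmx_trace_ge0/psdmx_gram.
by rewrite mulrn_wge0 // psdmx_trace_mul_ge0 //; exact: psdmx_negmx.
Qed.

(** At the minimal distance the two nonnegative terms of [trace_gram_sub_psdmx]
    besides the norm of the negative part have a nonpositive sum; hence the Choi
    matrix of Psi is the positive part. *)
Lemma hsnorm_le_neg_map_eq Psi : completely_positive Psi ->
  hsnorm (Phi \- Psi) <= hsnorm (neg_map Phi) -> Psi =1 pos_map Phi.
Proof.
move=> /psdmx_choi pX; have hM := choi_hermitian hermPhi.
rewrite /hsnorm choiB of_choiK ler_sqrtC ?qualifE /= ?psdmx_trace_ge0 //;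
  do ?exact: psdmx_gram.
rewrite trace_gram_sub_psdmx // -addrA addrCA gerDl => le0 A.
have K0 := psdmx_trace_ge0 (psdmx_gram (posmx (choi Phi) - choi Psi)).
have T0 : 0 <= \tr (choi Psi *m negmx (choi Phi)) *+ 2.
  by rewrite mulrn_wge0 // psdmx_trace_mul_ge0 //; exact: psdmx_negmx.
rewrite -[LHS]choiK; congr (of_choi _ A); apply/esym/eqP; rewrite -subr_eq0.
apply/eqP/trace_gram_eq0/le_anti; rewrite K0 andbT.
by apply: le_trans le0; rewrite lerDl.
Qed.

Lemma is_best_cp_approxP Psi : is_best_cp_approx Phi Psi <-> Psi =1 pos_map Phi.
Proof.
have cP := completely_positive_pos_map; split=> [[cPsi best]|eqPsi].
  apply: hsnorm_le_neg_map_eq => //.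
  by rewrite -hsnorm_sub_pos_map; apply: best.
split=> [|Psi' cPsi'].
  by apply: eq_completely_positive cP => A; rewrite eqPsi.
have -> : hsnorm (Phi \- Psi) = hsnorm (Phi \- pos_map Phi).
  by apply: eq_hsnorm => A /=; rewrite eqPsi.
by rewrite hsnorm_sub_pos_map; apply: hsnorm_neg_map_le.
Qed.

Lemma is_minimum_cp_distances :
  is_minimum (cp_distances Phi) (hsnorm (Phi \- pos_map Phi)).
Proof.
split=> [|_ [Psi [cPsi ->]]].
  by exists (pos_map Phi); split=> //; apply: completely_positive_pos_map.
by rewrite hsnorm_sub_pos_map; apply: hsnorm_neg_map_le.
Qed.

End Approximation.

Local Open Scope complex_scope.

Theorem theorem2p5 (R : realType) (m n : nat)
    (Phi : {linear 'M[R[i]]_m -> 'M[R[i]]_n}) :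
  hermitian_map Phi ->
  [/\ (completely_positive (pos_map Phi) /\ completely_positive (neg_map Phi)),
      Phi =1 (pos_map Phi \- neg_map Phi),
      (forall Psi : {linear 'M[R[i]]_m -> 'M[R[i]]_n},
         is_best_cp_approx Phi Psi <-> Psi =1 pos_map Phi),
      is_minimum (cp_distances Phi) (hsnorm (Phi \- pos_map Phi))
    & hsnorm (Phi \- pos_map Phi) = hsnorm (neg_map Phi)].
Proof.
move=> hPhi; split.
- split; first exact: completely_positive_pos_map.
  exact: completely_positive_neg_map.
- exact: jordan_decomposition_map.
- exact: is_best_cp_approxP.
- exact: is_minimum_cp_distances.
- exact: hsnorm_sub_pos_map.
Qed.
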